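(* Let $n\ge2$ and let $A$ be the adjacency matrix of a loopless undirected classical graph on $n$ vertices. Then $\omega(X_{A,\cdot})\ge\omega(A)-1$, where $\omega(A)$ is the usual clique number of the classical graph.
   Context: $M_n=M_n(\mathbb C)$, with matrix units $E_{ij}$; ''projector'' means orthogonal projector. For a loopless undirected classical graph with adjacency matrix $A$, $X_{A,\cdot}$ is the quantum graph on $M_n$ with adjacency operator $x\mapsto\sum_{i,j}A_{ij}x_{jj}E_{ii}$; its operator space is $S=\operatorname{span}\{E_{ij}:A_{ij}=1\}\subseteq M_n$. A $k$-clique of a quantum graph with operator space $S$ is a projector $P\in M_n$ of rank $k$ such that $P(S\oplus\mathbb CI)P=PM_nP$; equivalently, an isometry $V\colon\mathbb C^k\to\mathbb C^n$ with $V^\dagger(S\oplus\mathbb CI)V=M_k$. The clique number $\omega$ of the quantum graph is the largest $k$ for which a $k$-clique exists. *)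

(* Defs.v *)
From HB Require Import structures.
From mathcomp Require Import all_boot all_order all_algebra.
From mathcomp Require Import all_classical reals.
From mathcomp Require Export complex.

Set Implicit Arguments.
Unset Strict Implicit.
Unset Printing Implicit Defensive.

Import Order.TTheory GRing.Theory Num.Theory.
Local Open Scope ring_scope.
Local Open Scope sesquilinear_scope.

Section QuantumGraphs.
Variables (C : numClosedFieldType) (n : nat).
Local Notation Mn := 'M[C]_n.

(* The operator space of an adjacency operator T is the span of its Kraus
   operators. With a basis K_i orthonormal for Tr(X^dagger Y), the maps
   T(x) = sum_i K_i x K_i^dagger and the subspaces S determine each other. *)
Definition is_operator_space (T : Mn -> Mn) (S : {vspace Mn}) : Prop :=
  exists (r : nat) (K : 'I_r -> Mn),
    [/\ forall i j, \tr ((K i)^t* *m K j) = (i == j)%:R,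
        S = <<[seq K i | i : 'I_r]>>%VS
      & forall x, T x = \sum_i K i *m x *m (K i)^t*].

Record qgraph := QGraph {
  qadj : Mn -> Mn;
  qspace : {vspace Mn};
  qspaceP : is_operator_space qadj qspace
}.

Definition is_projector (P : Mn) : Prop := P *m P = P /\ P^t* = P.

Definition compression (P : Mn) : 'End(Mn) :=
  linfun (mulmxr P \o mulmx P).

Lemma compressionE P x : compression P x = P *m x *m P.
Proof. by rewrite /compression lfunE. Qed.

Definition is_qclique (X : qgraph) (k : nat) (P : Mn) : Prop :=
  [/\ is_projector P, \rank P = k
    & (compression P @: (qspace X + <[1%:M]>) = compression P @: fullv)%VS].

(* No generality is lost in bounding k by n, since rank P <= n. *)
Definition qclique_number (X : qgraph) : nat :=
  \max_(k < n.+1 | `[< exists P, is_qclique X k P >]) k.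

Lemma qclique0 (X : qgraph) : is_qclique X 0 0.
Proof.
split; [split | exact: mxrank0 | ]; first by rewrite mul0mx.
  by apply/matrixP=> i j; rewrite !mxE conjC0.
suff -> : compression 0 = 0 by rewrite !lim0g.
by apply/lfunP=> x; rewrite compressionE !mul0mx lfunE.
Qed.

Lemma qclique_numberP (X : qgraph) :
  (exists P, is_qclique X (qclique_number X) P) /\
  (forall k P, is_qclique X k P -> (k <= qclique_number X)%N).
Proof.
split=> [|k P cP].
  rewrite /qclique_number; have X0 : exists P, is_qclique X (ord0 : 'I_n.+1) P.
    by exists 0; apply: qclique0.
  rewrite (bigop.bigmax_eq_arg ord0) ?asboolT //.
  by case: arg_maxnP => [|i /asboolP //]; rewrite asboolT.
have le_kn : (k < n.+1)%N by case: cP => _ <- _; rewrite ltnS rank_leq_row.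
by apply: (bigop.leq_bigmax_cond (Ordinal le_kn)); apply/asboolP; exists P.
Qed.

End QuantumGraphs.

Section ClassicalGraphs.
Variables (C : numClosedFieldType) (n : nat) (e : rel 'I_n).
Local Notation Mn := 'M[C]_n.

Definition adjmx : Mn := \matrix_(i, j) (e i j)%:R.

Definition is_clique (K : {set 'I_n}) : bool :=
  [forall i in K, forall j in K, (i != j) ==> e i j].

Definition clique_number : nat := \max_(K : {set 'I_n} | is_clique K) #|K|.

Definition classical_qadj (x : Mn) : Mn :=
  \sum_i \sum_j (adjmx i j * x j j) *: delta_mx i i.

Definition classical_qspace : {vspace Mn} :=
  <<[seq delta_mx p.1 p.2 |
       p : 'I_n * 'I_n in [pred p | adjmx p.1 p.2 == 1]]>>%VS.

Lemma adjmx_eq1 i j : (adjmx i j == 1) = e i j.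
Proof. by rewrite mxE; case: (e i j); rewrite ?eqxx // eq_sym oner_eq0. Qed.

Lemma trCdelta (i j : 'I_n) : (delta_mx i j : Mn)^t* = delta_mx j i.
Proof. by apply/matrixP=> k l; rewrite !mxE conjC_nat andbC. Qed.

Lemma classical_qspaceP : is_operator_space classical_qadj classical_qspace.
Proof.
set D := [pred p : 'I_n * 'I_n | adjmx p.1 p.2 == 1].
exists #|D|, (fun i => let p := enum_val i in delta_mx p.1 p.2); split.
- move=> i j /=; rewrite trCdelta.
  rewrite (_ : (i == j) = (enum_val i == enum_val j)); last first.
    by rewrite (inj_eq enum_val_inj).
  case: (enum_val i) (enum_val j) => [a b] [c d] /=; rewrite xpair_eqE.
  have [<-|nac] := eqVneq a c; last by rewrite mul_delta_mx_0 // raddf0.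
  rewrite mul_delta_mx /mxtrace (bigD1 b) //= big1 ?addr0 ?mxE ?eqxx //=.
  by move=> k /negPf nkb; rewrite mxE nkb.
- apply: eq_span => x; apply/idP/idP.
    move=> /fintype.imageP[p Dp ->]; apply/codomP.
    by exists (enum_rank_in Dp p); rewrite //= enum_rankK_in.
  move=> /codomP[i ->]; apply/fintype.imageP.
  by exists (enum_val i) => //; apply: enum_valP.
move=> x.
rewrite -(big_enum_val (fun p => delta_mx p.1 p.2 *m x *m (delta_mx p.1 p.2)^t*)).
rewrite /classical_qadj pair_big [RHS]big_mkcond /=.
apply: eq_bigr => -[i j] _ /=; rewrite inE /= adjmx_eq1 mxE.
case: (e i j); rewrite ?mul0r ?scale0r // mul1r trCdelta.
apply/matrixP => a b; rewrite !mxE (bigD1 j) //= big1 ?addr0; last first.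
  by move=> k /negPf nkj; rewrite !mxE nkj mulr0.
rewrite !mxE (bigD1 j) //= big1 ?addr0; last first.
  by move=> k /negPf nkj; rewrite !mxE nkj andbF mul0r.
by rewrite !mxE !eqxx andbT /= mulrAC -natrM mulnb mulrC.
Qed.

Definition classical_qgraph : qgraph C n := QGraph classical_qspaceP.

(* For a loopless graph the sum S + C I is direct. *)
Lemma classical_qspace_direct (n_gt0 : (0 < n)%N) (e_irr : irreflexive e) :
  directv (classical_qspace + <[1%:M : Mn]>).
Proof.
suff tr0 x : x \in classical_qspace -> \tr x = 0.
  apply/directv_addP/eqP; rewrite -subv0; apply/subvP => x.
  rewrite memv_cap memv0 => /andP[/tr0 x0 /vlineP[a xa]].
  move: x0; rewrite xa mxtraceZ mxtrace1 => /eqP.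
  rewrite mulf_eq0 pnatr_eq0 -[n == _]negbK -lt0n n_gt0 orbF.
  by move=> /eqP->; rewrite scale0r.
move=> /coord_span->; rewrite raddf_sum big1 // => i _.
rewrite /= mxtraceZ; set s := image_tuple _ _.
have /fintype.imageP[p ep ->] : s`_i \in s by rewrite mem_nth // size_tuple.
move: ep; rewrite inE adjmx_eq1 /mxtrace => ep; rewrite big1 ?mulr0 // => k _.
rewrite mxE; case: (k =P p.1) => // k1; case: (k =P p.2) => // k2.
by move: ep; rewrite -k1 -k2 e_irr.
Qed.

End ClassicalGraphs.

Arguments adjmx C {n} e.
Arguments classical_qgraph C {n} e.

(* Main.v *)
Require Import Defs.
From HB Require Import structures.
From mathcomp Require Import all_boot all_order all_algebra.
From mathcomp Require Import reals.

Set Implicit Arguments.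
Unset Strict Implicit.
Unset Printing Implicit Defensive.

Import Order.TTheory GRing.Theory Num.Theory.
Local Open Scope ring_scope.
Local Open Scope sesquilinear_scope.

(** Let [K] be a clique with [m > 0] vertices, [u] its indicator vector and [P]
the projector onto the vectors supported on [K] and orthogonal to [u]. For [i]
in [K], the matrix [\sum_(j in K) E_ij] has every row a multiple of [u^T], and
[u^T P = 0]; so [P E_ii P] is minus the sum of the [P E_ij P] with [j] in [K]
distinct from [i], and these [E_ij] lie in the operator space. Hence [P], of
rank [m - 1], is a quantum clique. *)

Section CliqueProjector.
Variables (C : numClosedFieldType) (n : nat) (K : {set 'I_n}).

Definition indicator_col : 'cV[C]_n := \col_i (i \in K)%:R.
Definition support_mx : 'M[C]_n := diag_mx indicator_col^T.
(** For nonempty [K], the subtracted matrix is the orthogonal projector onto the line of [u]; [u] is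
    real, so its transpose is its adjoint. *)
Definition clique_projector : 'M[C]_n :=
  support_mx - #|K|%:R^-1 *: (indicator_col *m indicator_col^T).

Local Notation u := indicator_col.
Local Notation D := support_mx.
Local Notation P := clique_projector.

Lemma support_mx_delta (i j : 'I_n) : D *m delta_mx i j = (i \in K)%:R *: delta_mx i j.
Proof.
apply/matrixP => a b; rewrite mul_diag_mx !mxE.
by case: eqVneq => [->|]; rewrite ?mulr0.
Qed.

Lemma delta_mx_support (i j : 'I_n) : delta_mx i j *m D = (j \in K)%:R *: delta_mx i j.
Proof.
apply/matrixP => a b; rewrite mul_mx_diag !mxE mulrC.
by case: (eqVneq b j) => [->|]; rewrite ?andbF ?mulr0.
Qed.

Lemma support_mx_idem : D *m D = D.
Proof.
apply/matrixP => a b; rewrite mul_diag_mx !mxE.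
by case: (a \in K); rewrite ?mul1r // mul0r mul0rn.
Qed.

Lemma support_mx_col : D *m u = u.
Proof.
apply/matrixP => a b; rewrite mul_diag_mx !mxE.
by case: (a \in K); rewrite ?mul1r ?mul0r.
Qed.

Lemma row_support_mx : u^T *m D = u^T.
Proof. by rewrite -[D]trmxK -trmx_mul tr_diag_mx support_mx_col. Qed.

Lemma indicator_row_col : u^T *m u = #|K|%:R%:M.
Proof.
apply/matrixP => a b; rewrite !ord1 !mxE eqxx mulr1n -sum1_card natr_sum.
rewrite [RHS]big_mkcond /=; apply: eq_bigr => i _; rewrite !mxE.
by case: (i \in K); rewrite ?mulr1 ?mulr0.
Qed.

Lemma mxrank_support : (#|K| <= \rank D)%N.
Proof.
(* [M] selects the coordinates in [K], so it cuts [D] down to an identity block of size [#|K|]. *)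
pose M : 'M[C]_(#|K|, n) := rowsub (@enum_val _ (mem K)) 1%:M.
have MDM : M *m D *m M^T = 1%:M.
  apply/matrixP => a b; rewrite !mxE (bigD1 (enum_val b)) //= big1 ?addr0.
    rewrite mul_mx_diag !mxE eqxx mulr1 enum_valP mulr1.
    by rewrite (inj_eq enum_val_inj).
  move=> k /negPf kb; rewrite [M^T _ _]mxE [M _ _]mxE !mxE eq_sym kb.
  by rewrite mulr0.
rewrite -{1}(mxrank1 C #|K|) -MDM.
exact: leq_trans (mxrankM_maxl _ _) (mxrankM_maxr _ _).
Qed.

Lemma indicator_col_projector (K_gt0 : (0 < #|K|)%N) : P *m u = 0.
Proof.
rewrite mulmxBl support_mx_col -scalemxAl -mulmxA indicator_row_col mul_mx_scalar.
by rewrite scalerA mulVf ?scale1r ?subrr // pnatr_eq0 -lt0n.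
Qed.

Lemma clique_projector_tr : P^T = P.
Proof. by rewrite linearB linearZ /= trmx_mul trmxK tr_diag_mx. Qed.

Lemma indicator_row_projector (K_gt0 : (0 < #|K|)%N) : u^T *m P = 0.
Proof.
by rewrite -clique_projector_tr -trmx_mul indicator_col_projector ?trmx0.
Qed.

Lemma clique_projector_supportr : P *m D = P.
Proof.
by rewrite mulmxBl support_mx_idem -scalemxAl -mulmxA row_support_mx.
Qed.

Lemma clique_projector_supportl : D *m P = P.
Proof.
by rewrite mulmxBr support_mx_idem -scalemxAr mulmxA support_mx_col.
Qed.

Lemma is_projector_clique (K_gt0 : (0 < #|K|)%N) : is_projector P.
Proof.
split.
  rewrite [X in _ *m X]/clique_projector mulmxBr clique_projector_supportr.
  by rewrite -scalemxAr mulmxA indicator_col_projector // mul0mx scaler0 subr0.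
(* By symmetry it remains to see that conjugation fixes the entries, which are rational. *)
rewrite clique_projector_tr; apply/matrixP => i j; rewrite !mxE big_ord1 !mxE.
by rewrite rmorphB rmorphM fmorphV rmorphM rmorphMn /= !conjC_nat.
Qed.

(** [D] is [P] plus a matrix of rank at most one, and rank is subadditive. *)
Lemma mxrank_clique_projector : (#|K| - 1 <= \rank P)%N.
Proof.
rewrite leq_subLR; apply: leq_trans mxrank_support _.
rewrite -[D](subrK (#|K|%:R^-1 *: (u *m u^T))) addnC.
apply: leq_trans (mxrank_add _ _) _; rewrite leq_add2l.
exact: leq_trans (mxrank_scale _ _) (leq_trans (mxrankM_maxl _ _) (rank_leq_col _)).
Qed.

Lemma compression_sum_delta (K_gt0 : (0 < #|K|)%N) (i : 'I_n) :
  \sum_(j in K) compression P (delta_mx i j) = 0.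
Proof.
transitivity (compression P (\sum_(j in K) delta_mx i j)).
  by rewrite linear_sum.
rewrite compressionE.
suff -> : \sum_(j in K) delta_mx i j = delta_mx i 0 *m u^T.
  by rewrite mulmxA -mulmxA indicator_row_projector ?mulmx0.
apply/matrixP => a b; rewrite summxE mxE big_ord1 !mxE eqxx andbT.
rewrite big_mkcond (bigD1 b) //= big1 ?addr0 => [|j /negPf jb].
  by rewrite mxE eqxx andbT; case: (b \in K); rewrite ?mulr1 ?mulr0.
by rewrite mxE (eq_sym b) jb andbF; case: ifP.
Qed.

(** With the size written as [\rank P], a lower bound on that rank suffices later. It is enough to
    compress matrix units. *)
Lemma is_qclique_projector (e : rel 'I_n) (K_gt0 : (0 < #|K|)%N) :
  is_clique e K -> is_qclique (classical_qgraph C e) (\rank P) P.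
Proof.
move=> Ke; split=> //; first exact: is_projector_clique.
apply/eqP; rewrite eqEsubv limgS ?subvf //=.
set W := (_ @: (_ + _))%VS.
have offW i j : i \in K -> j \in K -> j != i -> compression P (delta_mx i j) \in W.
  move=> iK jK ji; apply/memv_img.
  apply: (subvP (addvSl _ _)); apply: memv_span.
  apply/fintype.imageP; exists (i, j) => //=; rewrite inE /= adjmx_eq1.
  move/forall_inP: Ke => /(_ i iK) /forall_inP /(_ j jK) /implyP; apply.
  by rewrite eq_sym.
apply/subvP => _ /memv_imgP[x _ ->]; rewrite [x]matrix_sum_delta.
rewrite linear_sum memv_suml // => i _; rewrite linear_sum memv_suml // => j _.
rewrite linearZ memvZ //=.
(* A matrix unit with an index outside [K] compresses to 0, since [P] absorbs [D] on both sides. *)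
case iK : (i \in K); last first.
  rewrite compressionE -clique_projector_supportr -(mulmxA P) support_mx_delta iK.
  by rewrite scale0r mulmx0 mul0mx mem0v.
case jK : (j \in K); last first.
  rewrite compressionE -{2}clique_projector_supportl mulmxA -(mulmxA P).
  by rewrite delta_mx_support jK scale0r mulmx0 mul0mx mem0v.
have [->|ji] := eqVneq j i; last exact: offW.
(* The vanishing row sum trades the diagonal unit for off-diagonal ones. *)
have := compression_sum_delta K_gt0 i; rewrite (bigD1 i) //= => /eqP.
rewrite addr_eq0 => /eqP->; rewrite memvN memv_suml // => k /andP[kK ki].
exact: offW.
Qed.

End CliqueProjector.

Theorem proposition4p45 (R : realType) (n : nat) (n_ge2 : (2 <= n)%N)
    (e : rel 'I_n) (e_sym : symmetric e) (e_irr : irreflexive e) :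
  (clique_number e - 1 <= qclique_number (classical_qgraph R[i] e))%N.
Proof.
(* Moving the 1 across lets the maximum be bounded clique by clique. For empty [K], truncated
   subtraction gives 0. *)
rewrite leq_subLR; apply/bigop.bigmax_leqP => K Ke; rewrite -leq_subLR.
have [->|K_gt0] := posnP #|K|; first by [].
apply: leq_trans (mxrank_clique_projector R[i] K) _.
exact: (qclique_numberP _).2 (is_qclique_projector R[i] K_gt0 Ke).
Qed.
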